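(* Let $G\dashv R$ be a monoidal adjunction with $G\colon\mathcal{C}\to\mathcal{D}$ and $R\colon\mathcal{D}\to\mathcal{C}$. If the projection formula holds for $R$, then $G\colon\mathcal{C}\to\mathcal{D}^G$ and $R\colon\mathcal{D}^G\to\mathcal{C}$, with the unit and counit of $G\dashv R$, form an adjunction of $\mathcal{C}$-bimodules.
   Context: Conventions: monoidal categories are written as if strict. Lax monoidal functors $F$ have structure maps $\mathrm{lax}^F_{X,Y}\colon FX\otimes FY\to F(X\otimes Y)$, $\mathrm{lax}^F_0$; if these are invertible ($F$ strong), the inverses are denoted $\mathrm{oplax}^F$. A monoidal adjunction is an adjunction with $G,R$ lax monoidal and monoidal unit and counit; then $G$ is strong. Projection formula: $\mathrm{lproj}_{A,X}=\mathrm{lax}^R_{GA,X}(\mathrm{unit}_A\otimes RX)\colon A\otimes RX\to R(GA\otimes X)$ and $\mathrm{rproj}_{X,A}=\mathrm{lax}^R_{X,GA}(RX\otimes\mathrm{unit}_A)\colon RX\otimes A\to R(X\otimes GA)$ are isomorphisms for all $A\in\mathcal{C}$, $X\in\mathcal{D}$. A $\mathcal{C}$-bimodule is a category $\mathcal{M}$ with a left action $\triangleright$ and a right action $\triangleleft$ of $\mathcal{C}$ (coherently associative and unital up to natural isomorphism) and a coherent natural isomorphism $(A\triangleright M)\triangleleft B\cong A\triangleright(M\triangleleft B)$. A $\mathcal{C}$-bimodule functor $F\colon\mathcal{M}\to\mathcal{N}$ is a functor with natural isomorphisms (lineators) $F(A\triangleright M)\cong A\triangleright FM$ and $F(M\triangleleft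 A)\cong FM\triangleleft A$ that are compatible with the associativity and unit isomorphisms of the left and right actions and with the bimodule isomorphisms. A $\mathcal{C}$-bimodule transformation is a natural transformation $\nu\colon F\to F'$ commuting with the left and right lineators. An adjunction of $\mathcal{C}$-bimodules is an adjunction internal to the bicategory of $\mathcal{C}$-bimodules: both functors are $\mathcal{C}$-bimodule functors, and unit and counit are $\mathcal{C}$-bimodule transformations (lineators of composites being the composites of lineators). $\mathcal{C}$ is a bimodule over itself via $\otimes$. $\mathcal{D}^G$ is the category $\mathcal{D}$ with $A\triangleright X=GA\otimes X$, $X\triangleleft A=X\otimes GA$, action associativity and unit isomorphisms induced by $\mathrm{oplax}^G$, and trivial bimodule isomorphism. The lineators of $G\colon\mathcal{C}\to\mathcal{D}^G$ are $\mathrm{oplax}^G_{A,B}\colon G(A\otimes B)\to GA\otimes GB$ (left) and $\mathrm{oplax}^G_{B,A}$ (right); the lineators of $R\colon\mathcal{D}^G\to\mathcal{C}$ are $(\mathrm{lproj}_{A,X})^{-1}\colon R(GA\otimes X)\to A\otimes RX$ and $(\mathrm{rproj}_{X,A})^{-1}\colon R(X\otimes GA)\to RX\otimes A$. *)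

(* Defs.v *)
From Corelib Require Import ssreflect.

Set Implicit Arguments.
Unset Strict Implicit.
Unset Printing Implicit Defensive.

Declare Scope cat_scope.
Delimit Scope cat_scope with cat.
Local Open Scope cat_scope.

#[local] Obligation Tactic := idtac.

(** * Categories, functors, transformations *)

Record Category := {
  Ob :> Type;
  Hom : Ob -> Ob -> Type;
  idm : forall X, Hom X X;
  comp : forall X Y Z, Hom Y Z -> Hom X Y -> Hom X Z;
  comp_id_l : forall X Y (f : Hom X Y), comp (idm Y) f = f;
  comp_id_r : forall X Y (f : Hom X Y), comp f (idm X) = f;
  comp_assoc : forall W X Y Z (h : Hom Y Z) (g : Hom X Y) (f : Hom W X),
    comp (comp h g) f = comp h (comp g f)
}.
Arguments Hom {_} _ _.
Arguments idm {_} _.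
Arguments comp {_ _ _ _} _ _.

Notation "g ∘ f" := (comp g f) (at level 40, left associativity) : cat_scope.

Record IsIso (C : Category) (X Y : C) (f : Hom X Y) := {
  inverse : Hom Y X;
  inverse_l : inverse ∘ f = idm X;
  inverse_r : f ∘ inverse = idm Y
}.

Record Iso (C : Category) (X Y : C) := {
  fwd :> Hom X Y;
  bwd : Hom Y X;
  bwd_fwd : bwd ∘ fwd = idm X;
  fwd_bwd : fwd ∘ bwd = idm Y
}.

Definition iso_sym (C : Category) (X Y : C) (i : Iso X Y) : Iso Y X :=
  {| fwd := bwd i; bwd := i; bwd_fwd := fwd_bwd i; fwd_bwd := bwd_fwd i |}.

Lemma iso_comp_bwd_fwd (C : Category) (X Y Z : C) (i : Iso X Y) (j : Iso Y Z) :
  (bwd i ∘ bwd j) ∘ (fwd j ∘ fwd i) = idm X.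
Proof.
by rewrite comp_assoc -(comp_assoc (bwd j)) bwd_fwd comp_id_l bwd_fwd.
Qed.

Definition iso_comp (C : Category) (X Y Z : C) (j : Iso Y Z) (i : Iso X Y) :
    Iso X Z :=
  {| fwd := j ∘ i; bwd := bwd i ∘ bwd j;
     bwd_fwd := iso_comp_bwd_fwd i j;
     fwd_bwd := iso_comp_bwd_fwd (iso_sym j) (iso_sym i) |}.

Definition iso_id (C : Category) (X : C) : Iso X X :=
  {| fwd := idm X; bwd := idm X;
     bwd_fwd := comp_id_l (idm X); fwd_bwd := comp_id_l (idm X) |}.

Definition inverse_iso (C : Category) (X Y : C) (f : Hom X Y) (h : IsIso f) :
    Iso Y X :=
  {| fwd := inverse h; bwd := f;
     bwd_fwd := inverse_r h; fwd_bwd := inverse_l h |}.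

Record Functor (C D : Category) := {
  fob :> C -> D;
  fmap : forall X Y, Hom X Y -> Hom (fob X) (fob Y);
  fmap_id : forall X, fmap (idm X) = idm (fob X);
  fmap_comp : forall X Y Z (g : Hom Y Z) (f : Hom X Y),
    fmap (g ∘ f) = fmap g ∘ fmap f
}.
Arguments fmap {_ _} _ {_ _} _.

Lemma fmap_iso_aux (C D : Category) (F : Functor C D) (X Y : C) (i : Iso X Y) :
  fmap F (bwd i) ∘ fmap F i = idm (F X).
Proof. by rewrite -fmap_comp bwd_fwd fmap_id. Qed.

Definition fmap_iso (C D : Category) (F : Functor C D) (X Y : C) (i : Iso X Y) :
    Iso (F X) (F Y) :=
  {| fwd := fmap F i; bwd := fmap F (bwd i);
     bwd_fwd := fmap_iso_aux F i; fwd_bwd := fmap_iso_aux F (iso_sym i) |}.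

Definition functor_id (C : Category) : Functor C C :=
  {| fob := fun X => X; fmap := fun X Y f => f;
     fmap_id := fun X => eq_refl; fmap_comp := fun X Y Z g f => eq_refl |}.

Program Definition functor_comp (C D E : Category)
    (G : Functor D E) (F : Functor C D) : Functor C E :=
  {| fob := fun X => G (F X); fmap := fun X Y f => fmap G (fmap F f) |}.
Next Obligation. by move=> C D E G F X; rewrite /= !fmap_id. Qed.
Next Obligation. by move=> C D E G F X Y Z g f; rewrite /= !fmap_comp. Qed.

Record NatTrans (C D : Category) (F G : Functor C D) := {
  component :> forall X, Hom (F X) (G X);
  naturality : forall X Y (f : Hom X Y),
    component Y ∘ fmap F f = fmap G f ∘ component X
}.

Record Bifunctor (C D E : Category) := {
  bob :> C -> D -> E;
  bmap : forall X X' Y Y', Hom X X' -> Hom Y Y' -> Hom (bob X Y) (bob X' Y');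
  bmap_id : forall X Y, bmap (idm X) (idm Y) = idm (bob X Y);
  bmap_comp : forall X X' X'' Y Y' Y'' (f' : Hom X' X'') (f : Hom X X')
      (g' : Hom Y' Y'') (g : Hom Y Y'),
    bmap (f' ∘ f) (g' ∘ g) = bmap f' g' ∘ bmap f g
}.
Arguments bmap {_ _ _} _ {_ _ _ _} _ _.

Lemma bmap_iso_aux (C D E : Category) (T : Bifunctor C D E)
    (X X' : C) (Y Y' : D) (i : Iso X X') (j : Iso Y Y') :
  bmap T (bwd i) (bwd j) ∘ bmap T i j = idm (T X Y).
Proof. by rewrite -bmap_comp !bwd_fwd bmap_id. Qed.

Definition bmap_iso (C D E : Category) (T : Bifunctor C D E)
    (X X' : C) (Y Y' : D) (i : Iso X X') (j : Iso Y Y') :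
    Iso (T X Y) (T X' Y') :=
  {| fwd := bmap T i j; bwd := bmap T (bwd i) (bwd j);
     bwd_fwd := bmap_iso_aux T i j;
     fwd_bwd := bmap_iso_aux T (iso_sym i) (iso_sym j) |}.

Record Adjunction (C D : Category) (G : Functor C D) (R : Functor D C) := {
  unit : NatTrans (functor_id C) (functor_comp R G);
  counit : NatTrans (functor_comp G R) (functor_id D);
  triangle_l : forall A : C, counit (G A) ∘ fmap G (unit A) = idm (G A);
  triangle_r : forall X : D, fmap R (counit X) ∘ unit (R X) = idm (R X)
}.

(** * Monoidal categories and monoidal adjunctions *)

Record MonoidalCategory := {
  mcat :> Category;
  tensor : Bifunctor mcat mcat mcat;
  one : mcat;
  assoc : forall A B C,
    Iso (tensor (tensor A B) C) (tensor A (tensor B C));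
  lunitor : forall A, Iso (tensor one A) A;
  runitor : forall A, Iso (tensor A one) A;
  assoc_nat : forall A A' B B' C C'
      (f : Hom A A') (g : Hom B B') (h : Hom C C'),
    assoc A' B' C' ∘ bmap tensor (bmap tensor f g) h =
    bmap tensor f (bmap tensor g h) ∘ assoc A B C;
  lunitor_nat : forall A A' (f : Hom A A'),
    lunitor A' ∘ bmap tensor (idm one) f = f ∘ lunitor A;
  runitor_nat : forall A A' (f : Hom A A'),
    runitor A' ∘ bmap tensor f (idm one) = f ∘ runitor A;
  pentagon : forall A B C D,
    bmap tensor (idm A) (assoc B C D) ∘ assoc A (tensor B C) D
      ∘ bmap tensor (assoc A B C) (idm D) =
    assoc A B (tensor C D) ∘ assoc (tensor A B) C D;
  triangle : forall A B,
    bmap tensor (idm A) (lunitor B) ∘ assoc A one B =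
    bmap tensor (runitor A) (idm B)
}.
Arguments tensor {_}.
Arguments one {_}.
Arguments assoc {_} _ _ _.
Arguments lunitor {_} _.
Arguments runitor {_} _.

Notation "A ⊗ B" := (bob tensor A B)
  (at level 35, right associativity) : cat_scope.
Notation "f ⊗m g" := (bmap tensor f g)
  (at level 35, right associativity) : cat_scope.

Record LaxMonoidalFunctor (C D : MonoidalCategory) := {
  lfun :> Functor C D;
  lax : forall A B, Hom (lfun A ⊗ lfun B) (lfun (A ⊗ B));
  lax0 : Hom one (lfun one);
  lax_nat : forall A A' B B' (f : Hom A A') (g : Hom B B'),
    lax A' B' ∘ (fmap lfun f ⊗m fmap lfun g) = fmap lfun (f ⊗m g) ∘ lax A B;
  lax_assoc : forall A B E,
    fmap lfun (assoc A B E) ∘ lax (A ⊗ B) E ∘ (lax A B ⊗m idm (lfun E)) =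
    lax A (B ⊗ E) ∘ (idm (lfun A) ⊗m lax B E)
      ∘ assoc (lfun A) (lfun B) (lfun E);
  lax_lunit : forall A,
    fmap lfun (lunitor A) ∘ lax one A ∘ (lax0 ⊗m idm (lfun A)) =
    lunitor (lfun A);
  lax_runit : forall A,
    fmap lfun (runitor A) ∘ lax A one ∘ (idm (lfun A) ⊗m lax0) =
    runitor (lfun A)
}.
Arguments lax {_ _} _ _ _.
Arguments lax0 {_ _} _.

Program Definition lax_id (C : MonoidalCategory) : LaxMonoidalFunctor C C :=
  {| lfun := functor_id C; lax := fun A B => idm (A ⊗ B); lax0 := idm one |}.
Next Obligation. by move=> *; rewrite /= comp_id_l comp_id_r. Qed.
Next Obligation. by move=> *; rewrite /= !bmap_id !comp_id_r !comp_id_l. Qed.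
Next Obligation. by move=> *; rewrite /= !bmap_id !comp_id_r. Qed.
Next Obligation. by move=> *; rewrite /= !bmap_id !comp_id_r. Qed.

Lemma bmap_comp_l (C D E : Category) (T : Bifunctor C D E) (X X' X'' : C) (Y : D)
    (f' : Hom X' X'') (f : Hom X X') :
  bmap T (f' ∘ f) (idm Y) = bmap T f' (idm Y) ∘ bmap T f (idm Y).
Proof. by rewrite -bmap_comp comp_id_l. Qed.

Lemma bmap_comp_r (C D E : Category) (T : Bifunctor C D E) (X : C) (Y Y' Y'' : D)
    (g' : Hom Y' Y'') (g : Hom Y Y') :
  bmap T (idm X) (g' ∘ g) = bmap T (idm X) g' ∘ bmap T (idm X) g.
Proof. by rewrite -bmap_comp comp_id_l. Qed.

Lemma lax_nat_l (C D : MonoidalCategory) (F : LaxMonoidalFunctor C D)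
    (A A' B : C) (f : Hom A A') :
  lax F A' B ∘ (fmap F f ⊗m idm (F B)) = fmap F (f ⊗m idm B) ∘ lax F A B.
Proof. by rewrite -(fmap_id F) lax_nat. Qed.

Lemma lax_nat_r (C D : MonoidalCategory) (F : LaxMonoidalFunctor C D)
    (A B B' : C) (g : Hom B B') :
  lax F A B' ∘ (idm (F A) ⊗m fmap F g) = fmap F (idm A ⊗m g) ∘ lax F A B.
Proof. by rewrite -(fmap_id F) lax_nat. Qed.

Lemma lax_assocE (C D : MonoidalCategory) (F : LaxMonoidalFunctor C D)
    (A B E : C) :
  fmap F (assoc A B E) ∘ (lax F (A ⊗ B) E ∘ (lax F A B ⊗m idm (F E))) =
  lax F A (B ⊗ E) ∘ ((idm (F A) ⊗m lax F B E) ∘ assoc (F A) (F B) (F E)).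
Proof. by rewrite -!comp_assoc lax_assoc. Qed.

Program Definition lax_comp (C D E : MonoidalCategory)
    (G : LaxMonoidalFunctor D E) (F : LaxMonoidalFunctor C D) :
    LaxMonoidalFunctor C E :=
  {| lfun := functor_comp G F;
     lax := fun A B => fmap G (lax F A B) ∘ lax G (F A) (F B);
     lax0 := fmap G (lax0 F) ∘ lax0 G |}.
Next Obligation.
move=> C D E G F A A' B B' f g /=.
by rewrite comp_assoc lax_nat -!comp_assoc -!fmap_comp lax_nat.
Qed.
Next Obligation.
move=> C D E G F A B H /=.
rewrite bmap_comp_l bmap_comp_r !comp_assoc.
rewrite -(comp_assoc (lax G _ _)) lax_nat_l.
rewrite !comp_assoc -(comp_assoc (fmap G (lax F (A ⊗ B) H))) -fmap_comp.
rewrite -(comp_assoc (fmap G _) (fmap G _)) -fmap_comp -(comp_assoc (fmap F _)) lax_assoc.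
rewrite !fmap_comp !comp_assoc lax_assocE.
by rewrite -(comp_assoc (lax G _ (F (B ⊗ H)))) lax_nat_r !comp_assoc.
Qed.
Next Obligation.
move=> C D E G F A /=.
rewrite bmap_comp_l !comp_assoc -(comp_assoc (lax G _ _)) lax_nat_l.
rewrite !comp_assoc -(comp_assoc (fmap G (lax F one A))) -fmap_comp.
by rewrite -comp_assoc -fmap_comp -(comp_assoc (fmap F _)) lax_lunit -comp_assoc lax_lunit.
Qed.
Next Obligation.
move=> C D E G F A /=.
rewrite bmap_comp_r !comp_assoc -(comp_assoc (lax G _ _)) lax_nat_r.
rewrite !comp_assoc -(comp_assoc (fmap G (lax F A one))) -fmap_comp.
by rewrite -comp_assoc -fmap_comp -(comp_assoc (fmap F _)) lax_runit -comp_assoc lax_runit.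
Qed.

Record IsMonoidalTransformation (C D : MonoidalCategory)
    (F G : LaxMonoidalFunctor C D) (nu : NatTrans F G) : Prop := {
  monoidal_lax : forall A B,
    nu (A ⊗ B) ∘ lax F A B = lax G A B ∘ (nu A ⊗m nu B);
  monoidal_lax0 : nu one ∘ lax0 F = lax0 G
}.

Record MonoidalAdjunction (C D : MonoidalCategory)
    (G : LaxMonoidalFunctor C D) (R : LaxMonoidalFunctor D C) := {
  madj :> Adjunction G R;
  unit_monoidal :
    @IsMonoidalTransformation C C (lax_id C) (lax_comp R G) (unit madj);
  counit_monoidal :
    @IsMonoidalTransformation D D (lax_comp G R) (lax_id D) (counit madj)
}.

Record IsStrong (C D : MonoidalCategory) (F : LaxMonoidalFunctor C D) := {
  lax_isiso : forall A B, IsIso (lax F A B);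
  lax0_isiso : IsIso (lax0 F)
}.

Definition oplax (C D : MonoidalCategory) (F : LaxMonoidalFunctor C D)
    (s : IsStrong F) (A B : C) : Iso (F (A ⊗ B)) (F A ⊗ F B) :=
  inverse_iso (lax_isiso s A B).

Definition oplax0 (C D : MonoidalCategory) (F : LaxMonoidalFunctor C D)
    (s : IsStrong F) : Iso (F one) one :=
  inverse_iso (lax0_isiso s).

Program Definition left_adjoint_lax_isiso (C D : MonoidalCategory)
    (G : LaxMonoidalFunctor C D) (R : LaxMonoidalFunctor D C)
    (a : MonoidalAdjunction G R) (A B : C) : IsIso (lax G A B) :=
  {| inverse := counit a (G A ⊗ G B)
       ∘ fmap G (lax R (G A) (G B) ∘ (unit a A ⊗m unit a B)) |}.
Next Obligation.
move=> C D G R a A B /=.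
rewrite fmap_comp !comp_assoc -lax_nat -(comp_assoc (fmap G _)).
have /= H := monoidal_lax (counit_monoidal a) (G A) (G B).
rewrite -comp_assoc H comp_id_l -bmap_comp.
have /= -> := triangle_l a A; have /= -> := triangle_l a B.
by rewrite bmap_id.
Qed.
Next Obligation.
move=> C D G R a A B /=.
have /= N := naturality (counit a) (lax G A B).
rewrite -comp_assoc -N comp_assoc -fmap_comp -comp_assoc.
have /= <- := monoidal_lax (unit_monoidal a) A B.
rewrite comp_id_r; exact: (triangle_l a (A ⊗ B)).
Qed.

Program Definition left_adjoint_lax0_isiso (C D : MonoidalCategory)
    (G : LaxMonoidalFunctor C D) (R : LaxMonoidalFunctor D C)
    (a : MonoidalAdjunction G R) : IsIso (lax0 G) :=
  {| inverse := counit a one ∘ fmap G (lax0 R) |}.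
Next Obligation.
move=> C D G R a /=; rewrite comp_assoc.
exact: (monoidal_lax0 (counit_monoidal a)).
Qed.
Next Obligation.
move=> C D G R a /=.
have /= N := naturality (counit a) (lax0 G).
rewrite -comp_assoc -N comp_assoc -fmap_comp.
have /= <- := monoidal_lax0 (unit_monoidal a).
rewrite comp_id_r; exact: (triangle_l a one).
Qed.

Definition left_adjoint_strong (C D : MonoidalCategory)
    (G : LaxMonoidalFunctor C D) (R : LaxMonoidalFunctor D C)
    (a : MonoidalAdjunction G R) : IsStrong G :=
  {| lax_isiso := left_adjoint_lax_isiso a;
     lax0_isiso := left_adjoint_lax0_isiso a |}.

(** * Projection formula *)

Definition lproj (C D : MonoidalCategory)
    (G : LaxMonoidalFunctor C D) (R : LaxMonoidalFunctor D C)
    (a : MonoidalAdjunction G R) (A : C) (X : D) :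
    Hom (A ⊗ R X) (R (G A ⊗ X)) :=
  lax R (G A) X ∘ (unit a A ⊗m idm (R X)).

Definition rproj (C D : MonoidalCategory)
    (G : LaxMonoidalFunctor C D) (R : LaxMonoidalFunctor D C)
    (a : MonoidalAdjunction G R) (X : D) (A : C) :
    Hom (R X ⊗ A) (R (X ⊗ G A)) :=
  lax R X (G A) ∘ (idm (R X) ⊗m unit a A).

Record ProjectionFormula (C D : MonoidalCategory)
    (G : LaxMonoidalFunctor C D) (R : LaxMonoidalFunctor D C)
    (a : MonoidalAdjunction G R) := {
  lproj_isiso : forall A X, IsIso (lproj a A X);
  rproj_isiso : forall X A, IsIso (rproj a X A)
}.

(** * Bimodules *)

(** Compatibility of [middle] with [lact_unit] and [ract_unit] is not listed:
    as for Kelly's redundant monoidal axioms, it follows from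
    [middle_lassoc], [middle_rassoc] and the triangles. *)
Record Bimodule (C : MonoidalCategory) := {
  bcat :> Category;
  lact : Bifunctor C bcat bcat;
  ract : Bifunctor bcat C bcat;
  lact_assoc : forall A B M, Iso (lact (A ⊗ B) M) (lact A (lact B M));
  lact_unit : forall M, Iso (lact one M) M;
  ract_assoc : forall M A B, Iso (ract M (A ⊗ B)) (ract (ract M A) B);
  ract_unit : forall M, Iso (ract M one) M;
  middle : forall A M B, Iso (ract (lact A M) B) (lact A (ract M B));
  lact_assoc_nat : forall A A' B B' M M'
      (f : Hom A A') (g : Hom B B') (h : Hom M M'),
    lact_assoc A' B' M' ∘ bmap lact (f ⊗m g) h =
    bmap lact f (bmap lact g h) ∘ lact_assoc A B M;
  lact_unit_nat : forall M M' (h : Hom M M'),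
    lact_unit M' ∘ bmap lact (idm one) h = h ∘ lact_unit M;
  ract_assoc_nat : forall M M' A A' B B'
      (h : Hom M M') (f : Hom A A') (g : Hom B B'),
    ract_assoc M' A' B' ∘ bmap ract h (f ⊗m g) =
    bmap ract (bmap ract h f) g ∘ ract_assoc M A B;
  ract_unit_nat : forall M M' (h : Hom M M'),
    ract_unit M' ∘ bmap ract h (idm one) = h ∘ ract_unit M;
  middle_nat : forall A A' M M' B B'
      (f : Hom A A') (h : Hom M M') (g : Hom B B'),
    middle A' M' B' ∘ bmap ract (bmap lact f h) g =
    bmap lact f (bmap ract h g) ∘ middle A M B;
  lact_pentagon : forall A B E M,
    bmap lact (idm A) (lact_assoc B E M) ∘ lact_assoc A (B ⊗ E) M
      ∘ bmap lact (assoc A B E) (idm M) =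
    lact_assoc A B (lact E M) ∘ lact_assoc (A ⊗ B) E M;
  lact_triangle : forall A M,
    bmap lact (idm A) (lact_unit M) ∘ lact_assoc A one M =
    bmap lact (runitor A) (idm M);
  ract_pentagon : forall M A B E,
    ract_assoc (ract M A) B E ∘ ract_assoc M A (B ⊗ E)
      ∘ bmap ract (idm M) (assoc A B E) =
    bmap ract (ract_assoc M A B) (idm E) ∘ ract_assoc M (A ⊗ B) E;
  ract_triangle : forall M A,
    bmap ract (ract_unit M) (idm A) ∘ ract_assoc M one A =
    bmap ract (idm M) (lunitor A);
  middle_lassoc : forall A B M E,
    bmap lact (idm A) (middle B M E) ∘ middle A (lact B M) E
      ∘ bmap ract (lact_assoc A B M) (idm E) =
    lact_assoc A B (ract M E) ∘ middle (A ⊗ B) M E;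
  middle_rassoc : forall A M B E,
    middle A (ract M B) E ∘ bmap ract (middle A M B) (idm E)
      ∘ ract_assoc (lact A M) B E =
    bmap lact (idm A) (ract_assoc M B E) ∘ middle A M (B ⊗ E)
}.
Arguments lact {_ _}.
Arguments ract {_ _}.
Arguments lact_assoc {_} _ _ _ _.
Arguments lact_unit {_} _ _.
Arguments ract_assoc {_} _ _ _ _.
Arguments ract_unit {_} _ _.
Arguments middle {_} _ _ _ _.

Notation "A ▷ M" := (bob lact A M)
  (at level 35, right associativity) : cat_scope.
Notation "f ▷m g" := (bmap lact f g)
  (at level 35, right associativity) : cat_scope.
Notation "M ◁ A" := (bob ract M A)
  (at level 34, left associativity) : cat_scope.
Notation "f ◁m g" := (bmap ract f g)
  (at level 34, left associativity) : cat_scope.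

Record Lineators (C : MonoidalCategory) (M N : Bimodule C)
    (F : Functor M N) := {
  llin : forall A X, Iso (F (A ▷ X)) (A ▷ F X);
  rlin : forall X A, Iso (F (X ◁ A)) (F X ◁ A)
}.

Record IsBimoduleFunctor (C : MonoidalCategory) (M N : Bimodule C)
    (F : Functor M N) (l : Lineators F) : Prop := {
  llin_nat : forall (A A' : C) (X X' : M) (f : Hom A A') (h : Hom X X'),
    llin l A' X' ∘ fmap F (f ▷m h) = (f ▷m fmap F h) ∘ llin l A X;
  rlin_nat : forall (X X' : M) (A A' : C) (h : Hom X X') (f : Hom A A'),
    rlin l X' A' ∘ fmap F (h ◁m f) = (fmap F h ◁m f) ∘ rlin l X A;
  llin_assoc : forall (A B : C) (X : M),
    (idm A ▷m llin l B X) ∘ llin l A (B ▷ X) ∘ fmap F (lact_assoc M A B X) =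
    lact_assoc N A B (F X) ∘ llin l (A ⊗ B) X;
  llin_unit : forall X : M,
    lact_unit N (F X) ∘ llin l one X = fmap F (lact_unit M X);
  rlin_assoc : forall (X : M) (A B : C),
    (rlin l X A ◁m idm B) ∘ rlin l (X ◁ A) B ∘ fmap F (ract_assoc M X A B) =
    ract_assoc N (F X) A B ∘ rlin l X (A ⊗ B);
  rlin_unit : forall X : M,
    ract_unit N (F X) ∘ rlin l X one = fmap F (ract_unit M X);
  lin_middle : forall (A : C) (X : M) (B : C),
    (idm A ▷m rlin l X B) ∘ llin l A (X ◁ B) ∘ fmap F (middle M A X B) =
    middle N A (F X) B ∘ (llin l A X ◁m idm B) ∘ rlin l (A ▷ X) B
}.

Definition lineators_id (C : MonoidalCategory) (M : Bimodule C) :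
    Lineators (functor_id M) :=
  @Build_Lineators C M M (functor_id M)
    (fun A X => iso_id (A ▷ X)) (fun X A => iso_id (X ◁ A)).

Definition lineators_comp (C : MonoidalCategory) (M N P : Bimodule C)
    (F : Functor M N) (F' : Functor N P)
    (l' : Lineators F') (l : Lineators F) : Lineators (functor_comp F' F) :=
  @Build_Lineators C M P (functor_comp F' F)
    (fun A X => iso_comp (llin l' A (F X)) (fmap_iso F' (llin l A X)))
    (fun X A => iso_comp (rlin l' (F X) A) (fmap_iso F' (rlin l X A))).

Record IsBimoduleTransformation (C : MonoidalCategory) (M N : Bimodule C)
    (F F' : Functor M N) (l : Lineators F) (l' : Lineators F')
    (nu : NatTrans F F') : Prop := {
  trans_llin : forall (A : C) (X : M),
    llin l' A X ∘ nu (A ▷ X) = (idm A ▷m nu X) ∘ llin l A X;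
  trans_rlin : forall (X : M) (A : C),
    rlin l' X A ∘ nu (X ◁ A) = (nu X ◁m idm A) ∘ rlin l X A
}.

(** An adjunction in the bicategory of bimodules; as 2-cells there are natural
    transformations, the triangle identities are those contained in
    [a : Adjunction F R]. *)
Record IsBimoduleAdjunction (C : MonoidalCategory) (M N : Bimodule C)
    (F : Functor M N) (R : Functor N M)
    (lF : Lineators F) (lR : Lineators R) (a : Adjunction F R) : Prop := {
  left_bimodule_functor : IsBimoduleFunctor lF;
  right_bimodule_functor : IsBimoduleFunctor lR;
  unit_bimodule_transformation :
    IsBimoduleTransformation (lineators_id M) (lineators_comp lR lF) (unit a);
  counit_bimodule_transformation :
    IsBimoduleTransformation (lineators_comp lF lR) (lineators_id N) (counit a)
}.

(** * The bimodules [C] and [D^G] *)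

Lemma iso_epi (C : Category) (X Y Z : C) (i : Iso X Y) (f g : Hom Y Z) :
  f ∘ i = g ∘ i -> f = g.
Proof.
by move=> e; rewrite -(comp_id_r f) -(comp_id_r g) -(fwd_bwd i) -!comp_assoc e.
Qed.

Lemma iso_mono (C : Category) (X Y Z : C) (i : Iso Y Z) (f g : Hom X Y) :
  i ∘ f = i ∘ g -> f = g.
Proof.
by move=> e; rewrite -(comp_id_l f) -(comp_id_l g) -(bwd_fwd i) !comp_assoc e.
Qed.

Lemma fwd_bwd_comp (C : Category) (X Y Z : C) (i : Iso X Y) (f : Hom Z Y) :
  i ∘ (bwd i ∘ f) = f.
Proof. by rewrite -comp_assoc fwd_bwd comp_id_l. Qed.

Lemma bwd_fwd_comp (C : Category) (X Y Z : C) (i : Iso X Y) (f : Hom Z X) :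
  bwd i ∘ (fwd i ∘ f) = f.
Proof. by rewrite -comp_assoc bwd_fwd comp_id_l. Qed.

Lemma assoc_bwd_nat (C : MonoidalCategory) (A A' B B' E E' : C)
    (f : Hom A A') (g : Hom B B') (h : Hom E E') :
  bwd (assoc A' B' E') ∘ (f ⊗m (g ⊗m h)) =
  ((f ⊗m g) ⊗m h) ∘ bwd (assoc A B E).
Proof.
apply: (iso_mono (i := assoc _ _ _)).
by rewrite fwd_bwd_comp -comp_assoc assoc_nat comp_assoc fwd_bwd comp_id_r.
Qed.

Lemma pentagon_bwd (C : MonoidalCategory) (A B E H : C) :
  bwd (assoc (A ⊗ B) E H) ∘ bwd (assoc A B (E ⊗ H))
    ∘ (idm A ⊗m assoc B E H) =
  (bwd (assoc A B E) ⊗m idm H) ∘ bwd (assoc A (B ⊗ E) H).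
Proof.
rewrite comp_assoc.
do 2 apply: (iso_mono (i := assoc _ _ _)); rewrite !fwd_bwd_comp.
rewrite -!comp_assoc -pentagon !comp_assoc -(comp_assoc (_ ⊗m idm H)).
by rewrite -bmap_comp_l fwd_bwd bmap_id comp_id_l fwd_bwd comp_id_r.
Qed.

Program Definition regular_bimodule (C : MonoidalCategory) : Bimodule C :=
  {| bcat := C; lact := tensor; ract := tensor;
     lact_assoc := assoc; lact_unit := lunitor;
     ract_assoc := fun M A B => iso_sym (assoc M A B); ract_unit := runitor;
     middle := assoc |}.
Next Obligation. by move=> *; rewrite /= assoc_nat. Qed.
Next Obligation. by move=> *; rewrite /= lunitor_nat. Qed.
Next Obligation. by move=> *; rewrite /= assoc_bwd_nat. Qed.
Next Obligation. by move=> *; rewrite /= runitor_nat. Qed.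
Next Obligation. by move=> *; rewrite /= assoc_nat. Qed.
Next Obligation. by move=> *; rewrite /= pentagon. Qed.
Next Obligation. by move=> *; rewrite /= triangle. Qed.
Next Obligation. by move=> *; rewrite /= pentagon_bwd. Qed.
Next Obligation.
by move=> C M A /=; rewrite -triangle comp_assoc fwd_bwd comp_id_r.
Qed.
Next Obligation. by move=> *; rewrite /= pentagon. Qed.
Next Obligation.
move=> C A M B E /=.
apply: (iso_epi (i := assoc (A ⊗ M) B E)).
rewrite !comp_assoc bwd_fwd comp_id_r.
apply: (iso_mono (i := bmap_iso tensor (iso_id A) (assoc M B E))).
rewrite /= -(comp_assoc _ (idm A ⊗m bwd _)) -bmap_comp_r fwd_bwd bmap_id.
by rewrite comp_id_l -!comp_assoc pentagon.
Qed.

Section Oplax.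

Variables (C D : MonoidalCategory) (G : LaxMonoidalFunctor C D).
Variable s : IsStrong G.

Lemma oplax_nat (A A' B B' : C) (f : Hom A A') (g : Hom B B') :
  oplax s A' B' ∘ fmap G (f ⊗m g) = (fmap G f ⊗m fmap G g) ∘ oplax s A B.
Proof.
apply: (iso_mono (i := iso_sym (oplax s A' B'))).
rewrite (bwd_fwd_comp (oplax s A' B')) /= -comp_assoc lax_nat comp_assoc.
by rewrite inverse_r comp_id_r.
Qed.

Lemma oplax_assoc (A B E : C) :
  (idm (G A) ⊗m oplax s B E) ∘ (oplax s A (B ⊗ E) ∘ fmap G (assoc A B E)) =
  assoc (G A) (G B) (G E) ∘ ((oplax s A B ⊗m idm (G E)) ∘ oplax s (A ⊗ B) E).
Proof.
apply: (iso_epi (i := iso_comp (iso_sym (oplax s (A ⊗ B) E))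
  (bmap_iso tensor (iso_sym (oplax s A B)) (iso_id (G E))))).
rewrite /= !comp_assoc lax_assocE.
rewrite (fwd_bwd_comp (oplax s A (B ⊗ E))) -comp_assoc -bmap_comp_r.
rewrite inverse_l bmap_id comp_id_l (fwd_bwd_comp (oplax s (A ⊗ B) E)).
by rewrite -bmap_comp_l inverse_l bmap_id comp_id_r.
Qed.

Lemma oplax_lunit (A : C) :
  lunitor (G A) ∘ ((oplax0 s ⊗m idm (G A)) ∘ oplax s one A) =
  fmap G (lunitor A).
Proof.
rewrite -lax_lunit !comp_assoc -(comp_assoc (lax0 G ⊗m _)) -bmap_comp_l.
by rewrite inverse_r bmap_id comp_id_l inverse_r comp_id_r.
Qed.

Lemma oplax_runit (A : C) :
  runitor (G A) ∘ ((idm (G A) ⊗m oplax0 s) ∘ oplax s A one) =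
  fmap G (runitor A).
Proof.
rewrite -lax_runit !comp_assoc -(comp_assoc (_ ⊗m lax0 G)) -bmap_comp_r.
by rewrite inverse_r bmap_id comp_id_l inverse_r comp_id_r.
Qed.

Program Definition restrict_lact : Bifunctor C D D :=
  {| bob := fun A X => G A ⊗ X;
     bmap := fun A A' X X' f h => fmap G f ⊗m h |}.
Next Obligation. by move=> A X; rewrite /= fmap_id bmap_id. Qed.
Next Obligation. by move=> *; rewrite /= fmap_comp bmap_comp. Qed.

Program Definition restrict_ract : Bifunctor D C D :=
  {| bob := fun X A => X ⊗ G A;
     bmap := fun X X' A A' h f => h ⊗m fmap G f |}.
Next Obligation. by move=> A X; rewrite /= fmap_id bmap_id. Qed.
Next Obligation. by move=> *; rewrite /= fmap_comp bmap_comp. Qed.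

(** [D^G]: as monoidal categories are not strict here, the trivial bimodule
    isomorphism is the associator of [D]. *)
Program Definition restrict_bimodule : Bimodule C :=
  {| bcat := D; lact := restrict_lact; ract := restrict_ract;
     lact_assoc := fun A B X =>
       iso_comp (assoc (G A) (G B) X)
         (bmap_iso tensor (oplax s A B) (iso_id X));
     lact_unit := fun X =>
       iso_comp (lunitor X) (bmap_iso tensor (oplax0 s) (iso_id X));
     ract_assoc := fun X A B =>
       iso_comp (iso_sym (assoc X (G A) (G B)))
         (bmap_iso tensor (iso_id X) (oplax s A B));
     ract_unit := fun X =>
       iso_comp (runitor X) (bmap_iso tensor (iso_id X) (oplax0 s));
     middle := fun A X B => assoc (G A) X (G B) |}.
Next Obligation.
move=> A A' B B' M M' f g h /=.
rewrite comp_assoc -bmap_comp oplax_nat comp_id_l -(comp_id_r h) bmap_comp.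
by rewrite -comp_assoc assoc_nat comp_id_r comp_assoc.
Qed.
Next Obligation.
move=> M M' h /=.
rewrite comp_assoc -bmap_comp fmap_id comp_id_l comp_id_r.
rewrite -(comp_id_l (inverse _)) -(comp_id_r h) bmap_comp.
by rewrite -comp_assoc lunitor_nat comp_id_l comp_id_r comp_assoc.
Qed.
Next Obligation.
move=> M M' A A' B B' h f g /=.
rewrite comp_assoc -bmap_comp oplax_nat comp_id_l -(comp_id_r h) bmap_comp.
by rewrite -comp_assoc assoc_bwd_nat comp_id_r comp_assoc.
Qed.
Next Obligation.
move=> M M' h /=.
rewrite comp_assoc -bmap_comp fmap_id comp_id_l comp_id_r.
rewrite -(comp_id_l (inverse _)) -(comp_id_r h) bmap_comp.
by rewrite -comp_assoc runitor_nat comp_id_l comp_id_r comp_assoc.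
Qed.
Next Obligation. by move=> *; rewrite /= assoc_nat. Qed.
Next Obligation.
move=> A B E M /=.
rewrite fmap_id bmap_comp_r !comp_assoc -(comp_assoc (_ ⊗m _ ⊗m _)).
rewrite -assoc_nat !comp_assoc -!bmap_comp_l.
have /= -> := oplax_assoc A B E.
rewrite !bmap_comp_l -(bmap_id tensor (G E) M).
rewrite -(comp_assoc (_ ⊗m _ ⊗m _)) -assoc_nat !comp_assoc.
by rewrite -!(comp_assoc (_ ⊗m assoc _ _ _)) -comp_assoc pentagon !comp_assoc.
Qed.
Next Obligation.
move=> A M /=.
rewrite fmap_id bmap_comp_r !comp_assoc -(comp_assoc (_ ⊗m _ ⊗m _)).
rewrite -assoc_nat !comp_assoc -bmap_comp_l -comp_assoc triangle -bmap_comp_l.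
by rewrite oplax_runit.
Qed.
Next Obligation.
move=> M A B E /=.
rewrite fmap_id bmap_comp_l -(bmap_id tensor M (G A)) !comp_assoc.
rewrite -!bmap_comp_r -(comp_assoc (_ ⊗m _)) -assoc_bwd_nat !comp_assoc.
rewrite -!bmap_comp_r.
have /= -> := oplax_assoc A B E.
rewrite !bmap_comp_r -(comp_assoc ((_ ⊗m _) ⊗m _)) -assoc_bwd_nat.
by rewrite -!comp_assoc pentagon_bwd.
Qed.
Next Obligation.
move=> M A /=.
rewrite fmap_id bmap_comp_l !comp_assoc -(comp_assoc ((_ ⊗m _) ⊗m _)).
rewrite -assoc_bwd_nat !comp_assoc -triangle !comp_assoc.
by rewrite fwd_bwd_comp -!bmap_comp_r oplax_lunit.
Qed.
Next Obligation.
move=> A B M E /=.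
rewrite !fmap_id bmap_comp_l -!comp_assoc pentagon !comp_assoc.
by rewrite assoc_nat bmap_id.
Qed.
Next Obligation.
move=> A M B E /=.
rewrite !fmap_id bmap_comp_r -(bmap_id tensor (G A) M) !comp_assoc.
rewrite -assoc_nat -!comp_assoc; congr (_ ∘ _).
exact: middle_rassoc (regular_bimodule D) _ _ _ _.
Qed.

End Oplax.

Arguments restrict_bimodule {_ _ _} _.

Definition left_adjoint_lineators (C D : MonoidalCategory)
    (G : LaxMonoidalFunctor C D) (s : IsStrong G) :
    @Lineators C (regular_bimodule C) (restrict_bimodule s) G :=
  @Build_Lineators C (regular_bimodule C) (restrict_bimodule s) G
    (fun A B => oplax s A B) (fun B A => oplax s B A).

Definition right_adjoint_lineators (C D : MonoidalCategory)
    (G : LaxMonoidalFunctor C D) (R : LaxMonoidalFunctor D C)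
    (a : MonoidalAdjunction G R) (s : IsStrong G) (p : ProjectionFormula a) :
    @Lineators C (restrict_bimodule s) (regular_bimodule C) R :=
  @Build_Lineators C (restrict_bimodule s) (regular_bimodule C) R
    (fun A X => inverse_iso (lproj_isiso p A X))
    (fun X A => inverse_iso (rproj_isiso p X A)).

(* Main.v *)
(** Every identity involving the inverse of [lproj] or [rproj] is proved in the
    equivalent form in which only the projection maps themselves occur. The
    associativity axioms and the middle axiom for [R] are then one identity,
    [lax_assoc_bmap], applied to units and identities. The action constraints of
    [D^G] enter through the monoidality of the unit, in the form
    [fmap R (oplax A B) ∘ unit (A ⊗ B) = lax R ∘ (unit A ⊗m unit B)];
    the statement about the counit comes down to its monoidality and a triangle
    identity. *)
From Corelib Require Import ssreflect.
Require Import Defs.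

Set Implicit Arguments.
Unset Strict Implicit.
Unset Printing Implicit Defensive.

Local Open Scope cat_scope.

(** With lineators for [i] and [j], the [bwd] arrows are composites of [lproj] and [rproj], so a
    lineator axiom for [R] reduces to a square between projection maps. *)
Lemma iso_square (C : Category) (X X' Y Y' : C) (i : Iso X Y) (j : Iso X' Y')
    (g : Hom X X') (k : Hom Y Y') :
  bwd j ∘ k = g ∘ bwd i -> j ∘ g = k ∘ i.
Proof.
move=> e; apply: (iso_mono (i := iso_sym j)); apply: (iso_epi (i := iso_sym i)).
by rewrite bwd_fwd_comp comp_assoc (comp_assoc k) fwd_bwd comp_id_r.
Qed.

(** This is [lax_assoc] precomposed with [(f ⊗m g) ⊗m h], which passes the associator by naturality.
    An identity in place of [h], [f] or [g] yields the left, right or middle axiom respectively. *)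
Lemma lax_assoc_bmap (C D : MonoidalCategory) (F : LaxMonoidalFunctor C D)
    (A B E : D) (X Y Z : C)
    (f : Hom A (F X)) (g : Hom B (F Y)) (h : Hom E (F Z)) :
  fmap F (assoc X Y Z) ∘ lax F (X ⊗ Y) Z ∘ ((lax F X Y ∘ (f ⊗m g)) ⊗m h) =
  lax F X (Y ⊗ Z) ∘ (f ⊗m (lax F Y Z ∘ (g ⊗m h))) ∘ assoc A B E.
Proof.
rewrite -{1}(comp_id_l h) -{2}(comp_id_l f) !bmap_comp -(comp_assoc (_ ∘ _)).
by rewrite lax_assoc !comp_assoc assoc_nat.
Qed.

(** * The strong functor [G] as a bimodule functor *)

Section LeftAdjoint.

Variables (C D : MonoidalCategory) (G : LaxMonoidalFunctor C D).
Variable s : IsStrong G.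

(** Right actions associate along the inverse associator, so the right lineator axiom needs
    [oplax_assoc] with both associators moved across. *)
Lemma oplax_assoc_bwd (A B E : C) :
  (oplax s A B ⊗m idm (G E)) ∘ oplax s (A ⊗ B) E ∘ fmap G (bwd (assoc A B E)) =
  bwd (assoc (G A) (G B) (G E)) ∘ (idm (G A) ⊗m oplax s B E)
    ∘ oplax s A (B ⊗ E).
Proof.
apply: (iso_mono (i := assoc _ _ _)).
apply: (iso_epi (i := fmap_iso G (assoc A B E))).
rewrite !comp_assoc /= -fmap_comp bwd_fwd fmap_id comp_id_r.
by rewrite fwd_bwd_comp; have /= -> := oplax_assoc s A B E.
Qed.

Lemma left_adjoint_bimodule_functor :
  IsBimoduleFunctor (left_adjoint_lineators s).
Proof.
split.
- move=> A A' X X' f h; exact: (oplax_nat s f h).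
- move=> X X' A A' h f; exact: (oplax_nat s h f).
- move=> A B X /=; rewrite fmap_id !comp_assoc; exact: (oplax_assoc s A B X).
- move=> X /=; rewrite comp_assoc; exact: (oplax_lunit s X).
- move=> X A B /=; rewrite fmap_id; exact: (oplax_assoc_bwd X A B).
- move=> X /=; rewrite comp_assoc; exact: (oplax_runit s X).
- move=> A X B /=; rewrite !fmap_id !comp_assoc; exact: (oplax_assoc s A X B).
Qed.

End LeftAdjoint.

(** * Identities for the projection maps, valid without their invertibility *)

Section ProjectionMaps.

Variables (C D : MonoidalCategory).
Variables (G : LaxMonoidalFunctor C D) (R : LaxMonoidalFunctor D C).
Variables (a : MonoidalAdjunction G R) (s : IsStrong G).

Lemma unit_oplax (A B : C) :
  fmap R (oplax s A B) ∘ unit a (A ⊗ B) =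
  lax R (G A) (G B) ∘ (unit a A ⊗m unit a B).
Proof.
have /= := monoidal_lax (unit_monoidal a) A B; rewrite comp_id_r => ->.
by rewrite -!comp_assoc -fmap_comp inverse_l fmap_id comp_id_l.
Qed.

Lemma unit_oplax0 : fmap R (oplax0 s) ∘ unit a one = lax0 R.
Proof.
have /= := monoidal_lax0 (unit_monoidal a); rewrite comp_id_r => ->.
by rewrite -comp_assoc -fmap_comp inverse_l fmap_id comp_id_l.
Qed.

Lemma lproj_nat (A A' : C) (X X' : D) (f : Hom A A') (h : Hom X X') :
  lproj a A' X' ∘ (f ⊗m fmap R h) = fmap R (fmap G f ⊗m h) ∘ lproj a A X.
Proof.
rewrite /lproj -comp_assoc -lax_nat !comp_assoc -!bmap_comp.
by have /= -> := naturality (unit a) f; rewrite comp_id_l comp_id_r.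
Qed.

Lemma rproj_nat (X X' : D) (A A' : C) (h : Hom X X') (f : Hom A A') :
  rproj a X' A' ∘ (fmap R h ⊗m f) = fmap R (h ⊗m fmap G f) ∘ rproj a X A.
Proof.
rewrite /rproj -comp_assoc -lax_nat !comp_assoc -!bmap_comp.
by have /= -> := naturality (unit a) f; rewrite comp_id_l comp_id_r.
Qed.

(** Brings iterated projection maps into the shape of [lax_assoc_bmap]; for [k] a unit it links
    [lproj] to [unit_oplax]. *)
Lemma lproj_comp_r (A Y : C) (X : D) (k : Hom Y (R X)) :
  lproj a A X ∘ (idm A ⊗m k) = lax R (G A) X ∘ (unit a A ⊗m k).
Proof. by rewrite /lproj comp_assoc -bmap_comp comp_id_l comp_id_r. Qed.

Lemma rproj_comp_l (Y A : C) (X : D) (k : Hom Y (R X)) :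
  rproj a X A ∘ (k ⊗m idm A) = lax R X (G A) ∘ (k ⊗m unit a A).
Proof. by rewrite /rproj comp_assoc -bmap_comp comp_id_l comp_id_r. Qed.

(** Naturality of [lax R] moves [oplax] next to [unit a (A ⊗ B)], which [unit_oplax] then splits. *)
Lemma fmap_oplax_lproj (A B : C) (X : D) :
  fmap R (oplax s A B ⊗m idm X) ∘ lproj a (A ⊗ B) X =
  lax R (G A ⊗ G B) X
    ∘ ((lax R (G A) (G B) ∘ (unit a A ⊗m unit a B)) ⊗m idm (R X)).
Proof.
rewrite /lproj -comp_assoc -lax_nat_l comp_assoc -bmap_comp_l.
by have /= -> := unit_oplax A B.
Qed.

Lemma fmap_oplax_rproj (X : D) (A B : C) :
  fmap R (idm X ⊗m oplax s A B) ∘ rproj a X (A ⊗ B) =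
  lax R X (G A ⊗ G B)
    ∘ (idm (R X) ⊗m (lax R (G A) (G B) ∘ (unit a A ⊗m unit a B))).
Proof.
rewrite /rproj -comp_assoc -lax_nat_r comp_assoc -bmap_comp_r.
by have /= -> := unit_oplax A B.
Qed.

Lemma lproj_assoc (A B : C) (X : D) :
  fmap R (assoc (G A) (G B) X ∘ (oplax s A B ⊗m idm X)) ∘ lproj a (A ⊗ B) X =
  lproj a A (G B ⊗ X) ∘ (idm A ⊗m lproj a B X) ∘ assoc A B (R X).
Proof.
by rewrite fmap_comp comp_assoc fmap_oplax_lproj -comp_assoc lax_assoc_bmap
  lproj_comp_r.
Qed.

Lemma rproj_assoc (X : D) (A B : C) :
  fmap R (bwd (assoc X (G A) (G B)) ∘ (idm X ⊗m oplax s A B))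
    ∘ rproj a X (A ⊗ B) =
  rproj a (X ⊗ G A) B ∘ (rproj a X A ⊗m idm B) ∘ bwd (assoc (R X) A B).
Proof.
rewrite fmap_comp comp_assoc fmap_oplax_rproj rproj_comp_l.
(* Both inverse associators are cancelled, since [lax_assoc_bmap] concerns the forward ones. *)
apply: (iso_epi (i := assoc _ _ _)).
apply: (iso_mono (i := fmap_iso R (assoc _ _ _))).
rewrite !comp_assoc (fwd_bwd_comp (fmap_iso R _)) bwd_fwd comp_id_r /=.
by rewrite -!comp_assoc lax_assoc_bmap.
Qed.

Lemma lproj_rproj_assoc (A : C) (X : D) (B : C) :
  fmap R (assoc (G A) X (G B)) ∘ rproj a (G A ⊗ X) B ∘ (lproj a A X ⊗m idm B) =
  lproj a A (X ⊗ G B) ∘ (idm A ⊗m rproj a X B) ∘ assoc A (R X) B.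
Proof.
by rewrite comp_assoc rproj_comp_l -comp_assoc lax_assoc_bmap lproj_comp_r.
Qed.

Lemma lproj_unit (X : D) :
  fmap R (lunitor X ∘ (oplax0 s ⊗m idm X)) ∘ lproj a one X = lunitor (R X).
Proof.
rewrite /lproj fmap_comp !comp_assoc -(comp_assoc (fmap R (_ ⊗m _))).
rewrite -lax_nat_l !comp_assoc -bmap_comp_l.
by have /= -> := unit_oplax0; rewrite -comp_assoc lax_lunit.
Qed.

Lemma rproj_unit (X : D) :
  fmap R (runitor X ∘ (idm X ⊗m oplax0 s)) ∘ rproj a X one = runitor (R X).
Proof.
rewrite /rproj fmap_comp !comp_assoc -(comp_assoc (fmap R (_ ⊗m _))).
rewrite -lax_nat_r !comp_assoc -bmap_comp_r.
by have /= -> := unit_oplax0; rewrite -comp_assoc lax_runit.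
Qed.

(** After precomposition with [lax G], monoidality splits the counit into
    [counit a (G A) ⊗m counit a X]; the first factor meets [fmap G (unit a A)] and vanishes by the
    triangle identity. *)
Lemma counit_lproj (A : C) (X : D) :
  counit a (G A ⊗ X) ∘ fmap G (lproj a A X) =
  (idm (G A) ⊗m counit a X) ∘ oplax s A (R X).
Proof.
apply: (iso_epi (i := iso_sym (oplax s A (R X)))) => /=.
rewrite !comp_assoc inverse_l comp_id_r /lproj fmap_comp comp_assoc -lax_nat_l.
rewrite -(comp_assoc (fmap G _)) -comp_assoc.
have /= -> := monoidal_lax (counit_monoidal a) (G A) X.
rewrite comp_id_l -bmap_comp comp_id_r.
by have /= -> := triangle_l a A.
Qed.

Lemma counit_rproj (X : D) (A : C) :
  counit a (X ⊗ G A) ∘ fmap G (rproj a X A) =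
  (counit a X ⊗m idm (G A)) ∘ oplax s (R X) A.
Proof.
apply: (iso_epi (i := iso_sym (oplax s (R X) A))) => /=.
rewrite !comp_assoc inverse_l comp_id_r /rproj fmap_comp comp_assoc -lax_nat_r.
rewrite -(comp_assoc (fmap G _)) -comp_assoc.
have /= -> := monoidal_lax (counit_monoidal a) X (G A).
rewrite comp_id_l -bmap_comp comp_id_r.
by have /= -> := triangle_l a A.
Qed.

(** * The bimodule axioms under the projection formula *)

Variable p : ProjectionFormula a.

Let L A X : Iso (R (G A ⊗ X)) (A ⊗ R X) := inverse_iso (lproj_isiso p A X).
Let P X A : Iso (R (X ⊗ G A)) (R X ⊗ A) := inverse_iso (rproj_isiso p X A).

Lemma right_adjoint_bimodule_functor :
  IsBimoduleFunctor (right_adjoint_lineators s p).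
Proof.
split.
- move=> A A' X X' f h; apply: (iso_square (i := L A X) (j := L A' X')).
  by rewrite /= lproj_nat.
- move=> X X' A A' h f; apply: (iso_square (i := P X A) (j := P X' A')).
  by rewrite /= rproj_nat.
- move=> A B X; apply: (iso_square (i := L (A ⊗ B) X)
    (j := iso_comp (bmap_iso tensor (iso_id A) (L B X)) (L A (G B ⊗ X)))).
  by have /= -> := lproj_assoc A B X.
- move=> X /=; apply: (iso_epi (i := iso_sym (L one X))).
  by rewrite /= comp_assoc inverse_l comp_id_r; have /= -> := lproj_unit X.
- move=> X A B; apply: (iso_square (i := P X (A ⊗ B))
    (j := iso_comp (bmap_iso tensor (P X A) (iso_id B)) (P (X ⊗ G A) B))).
  by have /= -> := rproj_assoc X A B.
- move=> X /=; apply: (iso_epi (i := iso_sym (P X one))).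
  by rewrite /= comp_assoc inverse_l comp_id_r; have /= -> := rproj_unit X.
(* Rebracketing groups the two lineators on the right into one composite isomorphism, as
   [iso_square] requires. *)
- move=> A X B /=; rewrite [RHS]comp_assoc.
  apply: (iso_square
    (i := iso_comp (bmap_iso tensor (L A X) (iso_id B)) (P (G A ⊗ X) B))
    (j := iso_comp (bmap_iso tensor (iso_id A) (P X B)) (L A (X ⊗ G B)))).
  by rewrite /= -lproj_rproj_assoc comp_assoc.
Qed.

(** Once the inverse projection map is cancelled, both the left and the right condition become
    [unit_oplax]. *)
Lemma unit_is_bimodule_transformation :
  IsBimoduleTransformation (lineators_id (regular_bimodule C))
    (lineators_comp (right_adjoint_lineators s p) (left_adjoint_lineators s))
    (unit a).
Proof.
split=> [A X | X A] /=; rewrite comp_id_r comp_assoc.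
- apply: (iso_mono (i := iso_sym (L A (G X)))).
  rewrite (bwd_fwd_comp (L A (G X))) /= lproj_comp_r.
  exact: unit_oplax.
- apply: (iso_mono (i := iso_sym (P (G X) A))).
  rewrite (bwd_fwd_comp (P (G X) A)) /= rproj_comp_l.
  exact: unit_oplax.
Qed.

Lemma counit_is_bimodule_transformation :
  IsBimoduleTransformation
    (lineators_comp (left_adjoint_lineators s) (right_adjoint_lineators s p))
    (lineators_id (restrict_bimodule s)) (counit a).
Proof.
split=> [A X | X A] /=; rewrite comp_id_l fmap_id -comp_assoc.
- apply: (iso_epi (i := fmap_iso G (iso_sym (L A X)))).
  rewrite /= comp_assoc -fmap_comp inverse_l fmap_id comp_id_r.
  exact: counit_lproj.
- apply: (iso_epi (i := fmap_iso G (iso_sym (P X A)))).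
  rewrite /= comp_assoc -fmap_comp inverse_l fmap_id comp_id_r.
  exact: counit_rproj.
Qed.

End ProjectionMaps.

Theorem lemma3p24 (C D : MonoidalCategory)
    (G : LaxMonoidalFunctor C D) (R : LaxMonoidalFunctor D C)
    (a : MonoidalAdjunction G R) (p : ProjectionFormula a) :
  IsBimoduleAdjunction
    (M := regular_bimodule C)
    (N := restrict_bimodule (left_adjoint_strong a))
    (left_adjoint_lineators (left_adjoint_strong a))
    (right_adjoint_lineators (left_adjoint_strong a) p)
    a.
Proof.
split.
- exact: left_adjoint_bimodule_functor.
- exact: right_adjoint_bimodule_functor.
- exact: unit_is_bimodule_transformation.
- exact: counit_is_bimodule_transformation.
Qed.
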